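(* Let $\theta$ be a positive real number and $G$ be a graph. Then the following two statements are equivalent: (1) $S(G)$ has largest eigenvalue at most $2\theta-1$; (2) $B_\theta(G)$ is positive semi-definite. If one of the equivalent conditions (1) and (2) holds, then $\operatorname{rank}((2\theta-1)\mathbf{I}-S(G))+1=\operatorname{rank}(B_\theta(G))$, $A(G)$ has least eigenvalue at least $-\theta$, and $p(G)\leq 2$ holds.
   Context: All graphs are finite, simple, undirected, without loops. $A(G)$ is the adjacency matrix of $G$, and the Seidel matrix of $G$ is $S(G)=\mathbf{J}-\mathbf{I}-2A(G)$, with $\mathbf{J}$ the all-ones matrix and $\mathbf{I}$ the identity matrix. For a positive real $\theta$ and real $t$, define $$B^{(t)}_{\theta}(G)=\begin{pmatrix} A(G)+\theta\mathbf{I} & \mathbf{j}\\ \mathbf{j}^\top & t\end{pmatrix},$$ where $\mathbf{j}$ is the all-ones column vector, and $B_\theta(G):=B^{(2)}_\theta(G)$. When $-\theta$ is at least... that is, when all eigenvalues of $A(G)$ are at least $-\theta$, define (with respect to this $\theta$) $p(G):=\min\{t\in\mathbb{R}\mid B^{(t)}_\theta(G)\text{ is positive semi-definite}\}$. *)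

(* Defs.v *)
From HB Require Import structures.
From mathcomp Require Export all_boot all_order all_algebra.
From mathcomp Require Export boolp classical_sets reals ereal.

Set Implicit Arguments.
Unset Strict Implicit.
Unset Printing Implicit Defensive.

Import Order.TTheory GRing.Theory Num.Theory.

Local Open Scope classical_set_scope.
Local Open Scope ring_scope.

Record sgraph := SGraph {
  vertex :> finType;
  adj : rel vertex;
  adj_sym : symmetric adj;
  adj_irr : irreflexive adj }.

Section Matrices.
Variable R : realType.

(* Rows and columns follow the enumeration of the vertices; every notion below
   is invariant under a simultaneous permutation of rows and columns. *)
Definition adjmx (G : sgraph) : 'M[R]_#|G| :=
  \matrix_(i, j) (adj (enum_val i) (enum_val j))%:R.

Definition seidelmx (G : sgraph) : 'M[R]_#|G| :=
  const_mx 1 - 1%:M - 2 *: adjmx G.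

Definition Bmx (theta t : R) (G : sgraph) : 'M[R]_(#|G| + 1) :=
  block_mx (adjmx G + theta%:M) (const_mx 1) (const_mx 1) t%:M.

Definition psdmx n (M : 'M[R]_n) : Prop :=
  M^T = M /\ forall x : 'cV[R]_n, 0 <= (x^T *m M *m x) 0 0.

(* The set of eigenvalues is finite, and nonempty when M is a symmetric matrix
   of positive order: the supremum and infimum are then attained. Only for the
   graph with no vertices do they take the values -oo and +oo. *)
Definition largest_eigenvalue n (M : 'M[R]_n) : \bar R :=
  ereal_sup [set a%:E | a in [set a : R | eigenvalue M a]].

Definition least_eigenvalue n (M : 'M[R]_n) : \bar R :=
  ereal_inf [set a%:E | a in [set a : R | eigenvalue M a]].

Definition is_min (A : set R) (m : R) : Prop := A m /\ lbound A m.

(* is_p theta G p means that p(G) exists and equals p. The minimum need not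
   exist: if the all-ones vector is not in the column space of
   A(G) + theta I, then no B^(t) is positive semi-definite. *)
Definition is_p (theta : R) (G : sgraph) (p : R) : Prop :=
  is_min [set t : R | psdmx (Bmx theta t G)] p.

End Matrices.

(* Main.v *)
Require Import Defs.
From mathcomp Require Import all_boot all_order all_algebra.
From mathcomp Require Import boolp classical_sets reals ereal.
From mathcomp Require Import ring lra.
Import Order.TTheory GRing.Theory Num.Theory.
Local Open Scope ring_scope.

(** Write [M = A(G) + theta I] and [j] for the all-ones vector. Since
    [S(G) = J - I - 2 A(G)], the matrix [(2 theta - 1) I - S(G)] equals
    [2 (M - (1/2) j j^T)], twice the Schur complement of the corner entry [2]
    in [B_theta(G)]. Completing the square is a unimodular congruence between
    [B_theta(G)] and the direct sum of that Schur complement with the block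
    [2] ([schur_congruence]), so both positive semi-definiteness
    ([psd_schur]) and the rank up to the extra [1] ([rank_schur]) pass between
    the two matrices.

    Translating bounds on eigenvalues into positive semi-definiteness requires
    that a real symmetric matrix with nonnegative eigenvalues is positive
    semi-definite. This is obtained without diagonalization. In an affine
    family [P + t Q] with [Q] positive semi-definite and nonzero, the set of
    [t] giving a positive semi-definite matrix has a minimum unless it is
    empty ([psd_pencil_min]). For [Q = I] the matrix at the minimal [t] is
    singular, because a nonsingular positive semi-definite matrix remains so
    after a small multiple of [I] is subtracted ([psd_unit_shift]); hence the
    opposite of the minimal [t] is an eigenvalue of [P], and [P] dominates
    this multiple of [I] ([min_eigenvalue]).

    The bound on the least eigenvalue of [A(G)] holds because [M] is a
    principal block of [B_theta(G)], and [p(G)] is the minimum of the family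
    above when [Q] is supported on the corner entry. *)

Section PositiveSemidefinite.
Variable R : realType.

Local Notation quad M x := ((x^T *m M *m x) 0 0).

(** * Positive semi-definite matrices *)

Lemma quadD n (M N : 'M[R]_n) (x : 'cV_n) :
  quad (M + N) x = quad M x + quad N x.
Proof. by rewrite mulmxDr mulmxDl mxE. Qed.

Lemma quadZ n (a : R) (M : 'M[R]_n) (x : 'cV_n) :
  quad (a *: M) x = a * quad M x.
Proof. by rewrite -scalemxAr -scalemxAl mxE. Qed.

Lemma quad_scalar n (a : R) (x : 'cV[R]_n) :
  quad a%:M x = a * \sum_i x i 0 ^+ 2.
Proof.
rewrite mul_mx_scalar -scalemxAl mxE; congr (_ * _).
by rewrite mxE; apply: eq_bigr => i _; rewrite mxE expr2.
Qed.

Lemma quad_sum n (M : 'M[R]_n) (x : 'cV_n) :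
  quad M x = \sum_j \sum_i M i j * (x i 0 * x j 0).
Proof.
rewrite mxE; apply: eq_bigr => j _; rewrite mxE mulr_suml.
by apply: eq_bigr => i _; rewrite mxE; ring.
Qed.

Lemma sum_sqr_gt0 n (x : 'cV[R]_n) : x != 0 -> 0 < \sum_i x i 0 ^+ 2.
Proof.
move=> x0; rewrite lt_def sumr_ge0 ?andbT; last by move=> i _; exact: sqr_ge0.
apply: contra x0; rewrite psumr_eq0; last by move=> i _; exact: sqr_ge0.
move=> /allP x0; apply/eqP/matrixP => i j; rewrite ord1 mxE.
by apply/eqP; have := x0 i (mem_index_enum i); rewrite sqrf_eq0.
Qed.

Lemma psdD n (M N : 'M[R]_n) : psdmx M -> psdmx N -> psdmx (M + N).
Proof.
move=> [sM pM] [sN pN]; split; first by rewrite linearD /= sM sN.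
by move=> x; rewrite quadD addr_ge0.
Qed.

Lemma psdZ n (a : R) (M : 'M[R]_n) : 0 <= a -> psdmx M -> psdmx (a *: M).
Proof.
move=> a0 [sM pM]; split; first by rewrite linearZ /= sM.
by move=> x; rewrite quadZ mulr_ge0.
Qed.

Lemma psdZ_iff n (a : R) (M : 'M[R]_n) :
  0 < a -> psdmx (a *: M) <-> psdmx M.
Proof.
move=> a0; split=> [pM|]; last exact/psdZ/ltW.
have := psdZ n a^-1 (a *: M).
by rewrite scalerA mulVf ?gt_eqF // scale1r; apply; rewrite ?invr_ge0 ?ltW.
Qed.

Lemma psd_scalar n (a : R) : 0 <= a -> psdmx (a%:M : 'M[R]_n).
Proof.
move=> a0; split; first exact: tr_scalar_mx.
move=> x; rewrite quad_scalar mulr_ge0 // sumr_ge0 // => i _.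
exact: sqr_ge0.
Qed.

Lemma psd_congr m n (C : 'M[R]_(m, n)) (M : 'M[R]_m) :
  psdmx M -> psdmx (C^T *m M *m C).
Proof.
move=> [sM pM]; split; first by rewrite !trmx_mul trmxK sM mulmxA.
by move=> x; have := pM (C *m x); rewrite trmx_mul !mulmxA.
Qed.

Lemma psd_diag_block m n (M : 'M[R]_m) (N : 'M[R]_n) :
  psdmx M -> psdmx N -> psdmx (block_mx M 0 0 N).
Proof.
move=> [sM pM] [sN pN]; split; first by rewrite tr_block_mx !trmx0 sM sN.
move=> x; rewrite -(vsubmxK x) tr_col_mx mul_row_block mul_row_col.
by rewrite !mulmx0 addr0 add0r mxE addr_ge0.
Qed.

Lemma psd_ulsubmx m n (M : 'M[R]_(m + n)) : psdmx M -> psdmx (ulsubmx M).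
Proof.
move=> /(psd_congr (m + n) m (col_mx 1%:M 0) M).
rewrite -{1}(submxK M) tr_col_mx trmx1 trmx0 mul_row_block mul_row_col.
by rewrite !mul0mx !mul1mx !addr0 mulmx1 mulmx0 addr0.
Qed.

(** * Schur complements *)

(** Completing the square in the last coordinate. *)
Lemma schur_congruence n (M : 'M[R]_n) (b : 'cV[R]_n) (t : R) : t != 0 ->
  let C := block_mx 1%:M 0 (t^-1 *: b^T) 1%:M : 'M[R]_(n + 1) in
  block_mx M b b^T t%:M =
    C^T *m block_mx (M - t^-1 *: (b *m b^T)) 0 0 t%:M *m C.
Proof.
move=> t0 /=; rewrite tr_block_mx !trmx1 trmx0 linearZ /= trmxK !mulmx_block.
rewrite !mulmx0 !mul0mx !mul1mx !mulmx1 !addr0 !add0r.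
rewrite mul_mx_scalar mul_scalar_mx scalerA divff // scale1r.
by rewrite scalerA divff // scale1r -scalemxAr subrK.
Qed.

Lemma psd_schur n (M : 'M[R]_n) (b : 'cV[R]_n) (t : R) : 0 < t ->
  psdmx (block_mx M b b^T t%:M) <-> psdmx (M - t^-1 *: (b *m b^T)).
Proof.
move=> t0; split=> [|pS]; last first.
  rewrite schur_congruence ?gt_eqF //; apply: psd_congr.
  by apply: psd_diag_block => //; exact/psd_scalar/ltW.
(* The columns of this matrix are the vectors whose last coordinate minimizes
   the form once the others are given. *)
move=> /(psd_congr (n + 1) n (col_mx 1%:M (- t^-1 *: b^T))).
rewrite -mulmxA mul_block_col mulmx1 mulmx1 mul_scalar_mx scalerA mulrN.
rewrite divff ?gt_eqF // scaleN1r subrr.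
rewrite tr_col_mx mul_row_col trmx1 mul1mx mulmx0 addr0.
by rewrite -scalemxAr scaleNr.
Qed.

Lemma rank_schur n (M : 'M[R]_n) (b : 'cV[R]_n) (t : R) : t != 0 ->
  \rank (block_mx M b b^T t%:M) = (\rank (M - t^-1 *: (b *m b^T))%R + 1)%N.
Proof.
move=> t0; rewrite schur_congruence //.
set C := block_mx _ _ _ _.
have uC : C \in unitmx by rewrite unitmxE det_lblock !det1 mulr1 unitr1.
rewrite mxrankMfree ?row_free_unit // -mxrank_tr trmx_mul trmxK.
rewrite mxrankMfree ?row_free_unit // mxrank_tr rank_diag_block_mx.
by congr addn; apply: mxrank_unit; rewrite unitmxE det_scalar1 unitfE.
Qed.

(** * Affine families of positive semi-definite matrices *)

(** Each vector constrains [t] by a condition affine in [t], so the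
    admissible set is closed, and a vector on which [Q] is positive bounds it
    from below. *)
Lemma psd_pencil_min n (P Q : 'M[R]_n) (t1 : R) (x0 : 'cV[R]_n) :
  psdmx Q -> 0 < quad Q x0 -> psdmx (P + t1 *: Q) ->
  exists m, is_min [set t | psdmx (P + t *: Q)]%classic m.
Proof.
move=> [sQ pQ] qx0 pt1.
set A := [set t | _]%classic.
have lbA (x : 'cV_n) : 0 < quad Q x -> lbound A (- quad P x / quad Q x).
  move=> qx t [_ /(_ x)]; rewrite quadD quadZ => ptx.
  by rewrite ler_pdivrMr // -subr_ge0 opprK addrC.
have At1 : A t1 by [].
exists (inf A); split; last first.
  by apply: ge_inf; exists (- quad P x0 / quad Q x0); exact: lbA.
split.
  have -> : P + inf A *: Q = (P + t1 *: Q) + (inf A - t1) *: Q.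
    by rewrite scalerBl addrACA subrr addr0.
  by rewrite linearD linearZ /= sQ pt1.1.
move=> x; rewrite quadD quadZ.
have := pQ x; rewrite le_eqVlt => /orP[/eqP qx|qx].
  by have := pt1.2 x; rewrite quadD quadZ -qx !mulr0.
have : - quad P x / quad Q x <= inf A.
  by apply: lb_le_inf; [exists t1 | exact: lbA].
by rewrite ler_pdivrMr // -subr_ge0 opprK addrC.
Qed.

(** * Least eigenvalues of symmetric matrices *)

Lemma scalar_dominates n (M : 'M[R]_n) : M^T = M ->
  exists2 K : R, 0 < K & psdmx (K%:M - M).
Proof.
move=> sM; pose K := 1 + \sum_j \sum_i `|M i j|.
have s0 : 0 <= \sum_j \sum_i `|M i j| by do 2?apply: sumr_ge0 => ? _.
exists K; first by rewrite ltr_pwDl.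
split=> [|x]; first by rewrite linearB /= tr_scalar_mx sM.
rewrite -scaleN1r quadD quadZ mulN1r subr_ge0 quad_scalar quad_sum.
set N := \sum_i x i 0 ^+ 2.
have N0 : 0 <= N by apply: sumr_ge0 => i _; exact: sqr_ge0.
have leN i : x i 0 ^+ 2 <= N.
  rewrite /N (bigD1 i) //= lerDl; apply: sumr_ge0 => ? _; exact: sqr_ge0.
rewrite mulrDl mul1r -[leLHS]add0r lerD // mulr_suml.
apply: ler_sum => j _; rewrite mulr_suml; apply: ler_sum => i _.
rewrite (le_trans (ler_norm _)) // normrM ler_wpM2l //.
rewrite ler_norml; apply/andP.
move: (leN i) (leN j) (sqr_ge0 (x i 0 + x j 0)) (sqr_ge0 (x i 0 - x j 0)).
by rewrite sqrrB sqrrD => *; split; lra.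
Qed.

(** If [K I] dominates the inverse of [N], then [1 / K] bounds [N] from below:
    with [s = 1 / K], the matrix [N - s I] is the sum of the congruence of [N]
    by [I - s N^-1] and of [s^2 (K I - N^-1)]. *)
Lemma psd_unit_shift n (N : 'M[R]_n) : psdmx N -> N \in unitmx ->
  exists2 e : R, 0 < e & psdmx (N - e%:M).
Proof.
move=> pN uN; have sN := pN.1.
have sV : (invmx N)^T = invmx N by rewrite trmx_inv sN.
have [K K0 pK] := scalar_dominates n (invmx N) sV.
exists K^-1; first by rewrite invr_gt0.
set s := K^-1.
have -> : N - s%:M = (1%:M - s *: invmx N)^T *m N *m (1%:M - s *: invmx N)
                     + s ^+ 2 *: (K%:M - invmx N).
  have sK : s ^+ 2 * K = s by rewrite expr2 -mulrA mulVf ?mulr1 ?gt_eqF.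
  have -> : (1%:M - s *: invmx N)^T = 1%:M - s *: invmx N.
    by rewrite linearB linearZ /= sV trmx1.
  rewrite mulmxBl mul1mx -scalemxAl mulVmx //.
  rewrite mulmxBr mulmx1 mulmxBl -!scalemxAl -!scalemxAr mulmxV // mul1mx.
  rewrite scalerBr [s ^+ 2 *: K%:M]scale_scalar_mx sK scalerA -expr2 !scalemx1.
  rewrite opprB [s%:M - _]addrC.
  by apply/matrixP => i j; rewrite !mxE; ring.
by apply: psdD; [exact: psd_congr | apply: psdZ => //; exact: sqr_ge0].
Qed.

(** At the least [t] for which [M + t I] is positive semi-definite this matrix
    is singular, since otherwise [t] could be lowered. *)
Lemma min_eigenvalue n (M : 'M[R]_n) : M^T = M -> (0 < n)%N ->
  exists2 a : R, eigenvalue M a & psdmx (M - a%:M).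
Proof.
move=> sM n0; have sNM : (- M)^T = - M by rewrite linearN /= sM.
have [K _ pK] := scalar_dominates n (- M) sNM.
pose x0 : 'cV[R]_n := const_mx 1.
have x0n : x0 != 0.
  apply/eqP => /matrixP /(_ (Ordinal n0) 0) /eqP.
  by rewrite !mxE oner_eq0.
have q0 : 0 < quad 1%:M x0 by rewrite quad_scalar mul1r sum_sqr_gt0.
have pK' : psdmx (M + K *: 1%:M) by rewrite scalemx1 addrC -[M]opprK.
have [t [/= pt lbt]] :=
  psd_pencil_min n M 1%:M K x0 (psd_scalar n 1 ler01) q0 pK'.
rewrite scalemx1 in pt.
have Nt : M + t%:M = M - (- t)%:M by rewrite raddfN /= opprK.
exists (- t); last by rewrite -Nt.
rewrite /eigenvalue /eigenspace -Nt kermx_eq0 row_free_unit; apply/negP => ut.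
have [e e0 pe] := psd_unit_shift n _ pt ut.
have : t <= t - e.
  by apply: lbt; rewrite /= scalemx1 raddfB /= addrA.
by rewrite lerDl oppr_ge0 leNgt e0.
Qed.

Lemma psd_shift_eigenvalue n (M : 'M[R]_n) (c : R) : M^T = M ->
  psdmx (M + c%:M) <-> forall a, eigenvalue M a -> - c <= a.
Proof.
move=> sM; split=> [pM a /eigenvalueP[v vM v0] | eM].
  have v0' : v^T != 0 by rewrite trmx_eq0.
  have := pM.2 v^T; rewrite trmxK mulmxDr mul_mx_scalar vM -scalerDl.
  have := quad_scalar n 1 v^T; rewrite trmxK mulmx1 mul1r => vv.
  by rewrite -scalemxAl mxE vv pmulr_lge0 ?sum_sqr_gt0 // -lerBlDr sub0r.
have [n0|n0] := posnP n.
  split; first by rewrite linearD /= sM tr_scalar_mx.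
  by move=> x; rewrite quad_sum big1 // => i; have := ltn_ord i; rewrite {2}n0.
have [a /eM ca pa] := min_eigenvalue n M sM n0.
have -> : M + c%:M = (M - a%:M) + (a + c)%:M by rewrite raddfD /= addrA subrK.
by apply: psdD => //; apply: psd_scalar; rewrite -lerBlDr sub0r.
Qed.

Lemma eigenvalueN n (M : 'M[R]_n) (a : R) :
  eigenvalue (- M) a = eigenvalue M (- a).
Proof.
apply/eigenvalueP/eigenvalueP => -[v vM v0]; exists v => //.
  by rewrite scaleNr -vM mulmxN opprK.
by rewrite mulmxN vM scaleNr opprK.
Qed.

Lemma least_eigenvalue_psd n (M : 'M[R]_n) (c : R) : M^T = M ->
  ((- c)%:E <= least_eigenvalue M)%E <-> psdmx (M + c%:M).
Proof.
move=> sM; rewrite psd_shift_eigenvalue //; split=> [cM a Ma | cM].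
  by rewrite -lee_fin (le_trans cM) //; apply: ereal_inf_lbound; exists a.
by apply: le_ereal_inf_tmp => _ [a /= Ma <-]; rewrite lee_fin cM.
Qed.

Lemma largest_eigenvalue_psd n (M : 'M[R]_n) (c : R) : M^T = M ->
  (largest_eigenvalue M <= c%:E)%E <-> psdmx (c%:M - M).
Proof.
move=> sM; rewrite addrC psd_shift_eigenvalue ?linearN /= ?sM //.
split=> [Mc a | Mc].
  rewrite eigenvalueN lerNl => Ma.
  by rewrite -lee_fin (le_trans _ Mc) //; apply: ereal_sup_ubound; exists (- a).
apply: ge_ereal_sup => _ [a /= Ma <-]; rewrite lee_fin -lerN2.
by apply: Mc; rewrite eigenvalueN opprK.
Qed.

(** * Adjacency and Seidel matrices *)

Lemma adjmx_sym (G : sgraph) : (adjmx R G)^T = adjmx R G.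
Proof. by apply/matrixP => i j; rewrite !mxE adj_sym. Qed.

Lemma seidelmx_sym (G : sgraph) : (seidelmx R G)^T = seidelmx R G.
Proof.
by rewrite /seidelmx !linearB linearZ /= adjmx_sym trmx1 trmx_const.
Qed.

Lemma BmxE (theta t : R) (G : sgraph) :
  Bmx theta t G =
    block_mx (adjmx R G + theta%:M) (const_mx 1) (const_mx 1)^T t%:M.
Proof. by rewrite trmx_const. Qed.

Lemma seidel_schur (theta : R) (G : sgraph) :
  (2 * theta - 1)%:M - seidelmx R G =
    2 *: (adjmx R G + theta%:M
          - 2^-1 *: (const_mx 1 *m (const_mx 1 : 'cV[R]_#|G|)^T)).
Proof.
rewrite /seidelmx scalerBr scalerA divff ?pnatr_eq0 // scale1r.
apply/matrixP => i j; rewrite !mxE big_ord1 !mxE.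
by case: (i == j); rewrite /= ?mulr1n ?mulr0n; ring.
Qed.

Lemma Bmx_pencil (theta t : R) (G : sgraph) :
  Bmx theta t G = Bmx theta 0 G + t *: block_mx 0 0 0 1%:M.
Proof.
rewrite /Bmx scale_block_mx add_block_mx !scaler0 !addr0.
by rewrite scalemx1 raddf0 add0r.
Qed.

Lemma is_p_exists (theta t : R) (G : sgraph) :
  psdmx (Bmx theta t G) -> exists p : R, is_p theta G p /\ p <= t.
Proof.
move=> pB.
pose Q : 'M[R]_(#|G| + 1) := block_mx 0 0 0 1%:M.
have pQ : psdmx Q.
  apply: psd_diag_block; last exact: psd_scalar.
  by rewrite -(raddf0 (@scalar_mx R _)); exact: psd_scalar.
have q0 : 0 < quad Q (col_mx 0 1%:M).
  rewrite tr_col_mx trmx0 trmx1 mul_row_block mul_row_col.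
  by rewrite !mulmx0 !add0r !mulmx1 mxE eqxx ltr01.
have [|m [Am lbm]] := psd_pencil_min _ (Bmx theta 0 G) Q t _ pQ q0.
  by rewrite -Bmx_pencil.
have mE : is_p theta G m.
  by split=> [|s /=]; rewrite /= Bmx_pencil //; exact: lbm.
by exists m; split=> //; exact: mE.2.
Qed.

End PositiveSemidefinite.

Theorem theorem2p3 (R : realType) (theta : R) (theta_gt0 : 0 < theta)
    (G : sgraph) :
  ((largest_eigenvalue (seidelmx R G) <= (2 * theta - 1)%:E)%E
     <-> psdmx (Bmx theta 2 G)) /\
  ((largest_eigenvalue (seidelmx R G) <= (2 * theta - 1)%:E)%E
     \/ psdmx (Bmx theta 2 G) ->
   [/\ (\rank ((2 * theta - 1)%:M - seidelmx R G)%R + 1)%N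
         = \rank (Bmx theta 2 G),
       ((- theta)%:E <= least_eigenvalue (adjmx R G))%E
     & exists p : R, is_p theta G p /\ p <= 2]).
Proof.
have equiv : (largest_eigenvalue (seidelmx R G) <= (2 * theta - 1)%:E)%E
    <-> psdmx (Bmx theta 2 G).
  rewrite largest_eigenvalue_psd ?seidelmx_sym // seidel_schur psdZ_iff //.
  by rewrite BmxE psd_schur.
split=> // hyp.
have pB : psdmx (Bmx theta 2 G) by case: hyp => // /equiv.
split; last exact: is_p_exists.
- rewrite BmxE rank_schur ?pnatr_eq0 // seidel_schur.
  by rewrite mxrank_scale_nz ?pnatr_eq0.
- apply/least_eigenvalue_psd; first exact: adjmx_sym.
  by have := psd_ulsubmx _ _ _ _ pB; rewrite block_mxKul.
Qed.
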